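(* Let $\gamma^*$ be the optimal open-loop policy, i.e. the relaxed control with density $$\dot\gamma^*_t(a)=\frac{\exp\big(\frac1\lambda\tilde H(t,y,a,\nabla v(t,y))\big)}{\int_U\exp\big(\frac1\lambda\tilde H(t,y,a',\nabla v(t,y))\big)\,da'},\qquad y=x^{\gamma^*}_t .$$ Then $\gamma^*$ can also be expressed as $$\dot\gamma^*_t(a)=\exp\Big(\tfrac1\lambda\,q(t,y,a;\gamma^* )\Big),\qquad y=x_t^{\gamma^*},\quad a\in U.$$
   Context: **Rough path setting.** Fix $T>0$ and $\alpha>1/3$, and write $\delta f_{st}=f_t-f_s$. The noise $\zeta:[0,T]\to\mathbb R^d$ is $\alpha$-Hölder with $\zeta_0=0$, equipped with a Lévy area $\zeta^2$ with $|\zeta^2_{st}|\lesssim|t-s|^{2\alpha}$, $\zeta^{2;ij}_{st}-\zeta^{2;ij}_{su}-\zeta^{2;ij}_{ut}=\delta\zeta^i_{su}\delta\zeta^j_{ut}$ and $\zeta^{2;ij}_{st}+\zeta^{2;ji}_{st}=\delta\zeta^i_{st}\delta\zeta^j_{st}$. For $1/3<\kappa<\alpha$, a $\kappa$-Hölder path $z$ is weakly controlled by $\zeta$ if $\delta z_{st}=z^\zeta_s\delta\zeta_{st}+\rho_{st}$ with $z^\zeta$ $\kappa$-Hölder and $|\rho_{st}|\lesssim|t-s|^{2\kappa}$; rough integrals are $\int_s^t\mu^i_rd\zeta^i_r=\lim\sum_q[\mu^i_{t_q}\delta\zeta^i_{t_qt_{q+1}}+\mu^{\zeta;ii_1}_{t_q}\zeta^{2;i_1i}_{t_qt_{q+1}}]$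 as the mesh tends to $0$, and rough differential equations are integral equations for weakly controlled paths with this integral. **Dynamics.** $U\subset\mathbb R^d$ is a compact domain, $\mathcal P(U)$ the set of probability measures on $U$, $\dot\gamma$ the Lebesgue density of $\gamma\in\mathcal P(U)$; the state space $\mathcal K\subset\mathcal P(U)$ of relaxed controls is of the form $\{\mu\in\mathcal P(U):\mu\text{ has a density }\dot\mu\ge\beta_0\}$ for a constant $\beta_0>0$. $b\in\mathcal C_b^{0,1,1}([0,T]\times\mathbb R^m\times U;\mathbb R^m)$ is uniformly continuous in time and Lipschitz in space uniformly in time and control; $\sigma\in\mathcal C_b^{1,3}([0,T]\times\mathbb R^m;\mathbb R^{m,d})$. For a relaxed control $\gamma$, $x^{s,y,\gamma}$ is the unique solution of $x_t=y+\int_s^t\int_Ub(r,x_r,a)\gamma_r(da)dr+\int_s^t\sigma(r,x_r)d\zeta_r$; $x^{\gamma}=x^{0,x_0,\gamma}$ for a given initial state $x_0$. **Reward.** With $\lambda>0$, $F(s,x,\gamma)=\int_UR(s,x,u)\dot\gamma(u)\,du-\lambda\int_U\dot\gamma(u)\log\dot\gamma(u)\,du$, assumed bounded, Lipschitz in $x$ uniformly in $\gamma\in\mathcal K$ and Lipschitz in $\gamma\in\mathcal K$; for a Dirac mass the entropy term is set to $0$ by convention, so $F(s,x,\delta_a)=R(s,x,a)$. $G:\mathbb R^m\to\mathbb R$ is bounded and continuous. $J_{t,T}(y;\gamma)=\int_t^TF(r,x^{t,y,\gamma}_r,\gamma_r)dr+G(x^{t,y,\gamma}_T)$, and $\tilde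 H(t,y,a,p)=p\cdot b(t,y,a)+R(t,y,a)$. The function $v$ is the unique rough viscosity solution of $\partial_tv+\sup_{\gamma\in\mathcal P(U)}\int_U[\tilde H(t,y,a,\nabla v)-\lambda\log\dot\gamma(a)]\dot\gamma(a)\,da+\nabla v\cdot\sigma\,\dot\zeta_t=0$, $v(T,\cdot)=G$; it is the value function $v(t,y)=\sup_\gamma J_{t,T}(y;\gamma)$. The control $\gamma^*$ is optimal, $v(t,x_t^{\gamma^*})=J_{t,T}(x^{\gamma^*}_t;\gamma^* )$, and $\nabla v(t,x^{\gamma^*}_t)=\nabla_xJ_{t,T}(x^{\gamma^*}_t;\gamma^* )$, where $\nabla v,\nabla_xJ$ are gradients in the space variable, assumed to exist. **$q$-function.** For a control $\gamma$, $\mu\in\mathcal P(U)$ and $\beta>0$ let $\hat\gamma^\beta$ equal $\mu$ on $[t,t+\beta]$ and $\gamma$ elsewhere, $Q_\beta(t,y,\mu;\gamma)=J_{t,T}(y;\hat\gamma^\beta)$, and $q(t,y,\mu;\gamma)=\lim_{\beta\downarrow0}\beta^{-1}(Q_\beta(t,y,\mu;\gamma)-J_{t,T}(y;\gamma))$. For $a\in U$, $q(t,y,a;\gamma):=q(t,y,\delta_a;\gamma)$. Equivalently, $q(t,y,\mu;\gamma)=H(t,y,\mu,\nabla_xJ_{t,T}(y;\gamma))-H(t,y,\gamma_t,\nabla_xJ_{t,T}(y;\gamma))$ with $H(t,y,\gamma,p)=p\cdot\int_Ub(t,y,a)\gamma(da)+F(t,y,\gamma)$. *)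

(* Defs.v *)
From HB Require Import structures.
From mathcomp Require Import all_boot all_order all_algebra.
From mathcomp Require Import all_classical all_reals all_analysis.
From mathcomp Require Import measurable_realfun.

Set Implicit Arguments.
Unset Strict Implicit.
Unset Printing Implicit Defensive.

Import Order.TTheory GRing.Theory Num.Theory.
Import numFieldNormedType.Exports.

Local Open Scope classical_set_scope.
Local Open Scope ring_scope.

(* R^n with its Borel sigma-algebra; convertible to 'rV[R]_n. *)
Notation borel R n := (g_sigma_algebraType (@open 'rV[R]_n)).

Section calculus.
Context (R : realType).

Definition dotp n (p q : 'rV[R]_n) : R := \sum_i p 0 i * q 0 i.

Definition pderiv n (i : 'I_n) (f : 'rV[R]_n -> R) : 'rV[R]_n -> R :=
  fun x => 'D_(delta_mx 0 i) f x.

Definition grad n (f : 'rV[R]_n -> R) (x : 'rV[R]_n) : 'rV[R]_n :=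
  \row_i pderiv i f x.

Definition cont_bounded_on (X : topologicalType) (D : set X) (f : X -> R) :=
  {within D, continuous f} /\ exists C, forall z, D z -> `|f z| <= C.

(* At the endpoints of the time interval and on the boundary of U, a C^1
   function is one whose derivative, taken in the interior, extends
   continuously. *)
Definition Cb13 (T : R) m (f : R -> 'rV[R]_m -> R) :=
  let D := [set z : R * 'rV[R]_m | 0 <= z.1 <= T] in
  (forall l : seq 'I_m, (size l <= 3)%N ->
     cont_bounded_on D (fun z => foldr (@pderiv m) (f z.1) l z.2)) /\
  (forall (l : seq 'I_m) i t x, (size l < 3)%N -> 0 <= t <= T ->
     derivable (foldr (@pderiv m) (f t) l) x (delta_mx 0 i)) /\
  exists ft : R -> 'rV[R]_m -> R,
     cont_bounded_on D (fun z => ft z.1 z.2) /\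
     forall t x, 0 < t < T -> is_derive t 1 (fun r => f r x) (ft t x).

Definition Cb011 (T : R) m d (U : set 'rV[R]_d)
    (f : R -> 'rV[R]_m -> 'rV[R]_d -> R) :=
  let D := [set z : R * 'rV[R]_m * 'rV[R]_d | 0 <= z.1.1 <= T /\ U z.2] in
  let cb (g : R -> 'rV[R]_m -> 'rV[R]_d -> R) :=
    cont_bounded_on D (fun z => g z.1.1 z.1.2 z.2) in
  cb f /\
  (forall i, exists g, cb g /\ forall t x a, 0 <= t <= T -> U a ->
     is_derive x (delta_mx 0 i) (fun y => f t y a) (g t x a)) /\
  (forall i, exists g, cb g /\ forall t x a, 0 <= t <= T -> U° a ->
     is_derive a (delta_mx 0 i) (fun u => f t x u) (g t x a)).

Definition compact_domain d (U : set 'rV[R]_d) :=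
  compact U /\
  exists O : set 'rV[R]_d, [/\ open O, connected O, O !=set0 & U = closure O].

(* This determines the d-dimensional Lebesgue measure on Borel sets. *)
Definition is_lebesgue d (leb : set (borel R d) -> \bar R) :=
  forall a b : 'rV[R]_d, (forall i, a 0 i <= b 0 i) ->
    leb [set x | forall i, a 0 i <= x 0 i <= b 0 i]
    = (\prod_i (b 0 i - a 0 i))%:E.

End calculus.

Section rough_paths.
Context (R : realType) (d : nat).

Definition holder (V : normedModType R) (k a b : R) (f : R -> V) :=
  exists C, forall s t, a <= s -> s <= t -> t <= b ->
    `|f t - f s| <= C * (t - s) `^ k.

Record rough_path (T alpha : R) (zeta : R -> 'rV[R]_d)
    (zeta2 : R -> R -> 'M[R]_d) : Prop := {
  rp_holder : holder alpha 0 T zeta ;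
  rp_init : zeta 0 = 0 ;
  rp_area : exists C, forall s t, 0 <= s -> s <= t -> t <= T ->
    `|zeta2 s t| <= C * (t - s) `^ (2 * alpha) ;
  rp_chen : forall s u t, 0 <= s -> s <= u -> u <= t -> t <= T ->
    forall i j, zeta2 s t i j - zeta2 s u i j - zeta2 u t i j
    = (zeta u 0 i - zeta s 0 i) * (zeta t 0 j - zeta u 0 j) ;
  rp_geometric : forall s t, 0 <= s -> s <= t -> t <= T ->
    forall i j, zeta2 s t i j + zeta2 s t j i
    = (zeta t 0 i - zeta s 0 i) * (zeta t 0 j - zeta s 0 j) }.

Definition weakly_controlled (zeta : R -> 'rV[R]_d) (kappa a b : R) n
    (z : R -> 'rV[R]_n) (dz : R -> 'M[R]_(n, d)) :=
  [/\ holder kappa a b z, holder kappa a b dz &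
    exists C, forall s t, a <= s -> s <= t -> t <= b ->
      `|z t - z s - (zeta t - zeta s) *m (dz s)^T|
      <= C * (t - s) `^ (2 * kappa)].

(* Compensated Riemann sum over the partition a :: l. *)
Definition rough_sum (zeta : R -> 'rV[R]_d) (zeta2 : R -> R -> 'M[R]_d)
    (mu : R -> 'rV[R]_d) (dmu : R -> 'M[R]_d)
    (a : R) (l : seq R) : R :=
  \sum_(q < size l)
    let u := nth a (a :: l) q in let v := nth a l q in
    \sum_i (mu u 0 i * (zeta v 0 i - zeta u 0 i)
            + \sum_j dmu u i j * zeta2 u v j i).

Definition is_rough_integral (zeta : R -> 'rV[R]_d) (zeta2 : R -> R -> 'M[R]_d)
    (mu : R -> 'rV[R]_d) (dmu : R -> 'M[R]_d) (a b I : R) :=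
  forall eps, 0 < eps -> exists2 eta, 0 < eta &
    forall l, itv_partition a b l ->
      (forall q, (q < size l)%N -> nth a l q - nth a (a :: l) q < eta) ->
      `|rough_sum zeta zeta2 mu dmu a l - I| < eps.

End rough_paths.

Record control_problem (R : realType) (d m : nat) := ControlProblem {
  cp_horizon : R ;
  cp_alpha : R ;
  cp_kappa : R ;
  cp_zeta : R -> 'rV[R]_d ;
  cp_zeta2 : R -> R -> 'M[R]_d ;
  cp_U : set 'rV[R]_d ;
  cp_leb : {measure set (borel R d) -> \bar R} ;
  cp_b : R -> 'rV[R]_m -> 'rV[R]_d -> 'rV[R]_m ;
  cp_sigma : R -> 'rV[R]_m -> 'M[R]_(m, d) ;
  cp_lambda : R ;
  cp_reward : R -> 'rV[R]_m -> 'rV[R]_d -> R ;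
  cp_terminal : 'rV[R]_m -> R ;
  cp_beta0 : R ;
  cp_K : set (probability (borel R d) R) }.

Section control.
Context (R : realType) (d m : nat) (p : control_problem R d m).

Local Notation prob := (probability (borel R d) R).
Local Notation T := (cp_horizon p).
Local Notation U := (cp_U p).
Local Notation b := (cp_b p).
Local Notation sigma := (cp_sigma p).
Local Notation rw := (cp_reward p).
Implicit Types (s t r : R) (x y P : 'rV[R]_m) (a : 'rV[R]_d) (mu : prob)
  (gam : R -> prob).

Definition dirac_prob a : prob := @dirac _ (borel R d) a R.

Definition is_density mu (f : 'rV[R]_d -> R) :=
  [/\ measurable_fun [set: borel R d] (f : borel R d -> R),
      forall a, 0 <= f a &
      forall A : set (borel R d), measurable A ->
        mu A = (\int[cp_leb p]_(a in A) (f a)%:E)%E].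

Definition has_density mu := exists f, is_density mu f.

Definition density mu : 'rV[R]_d -> R := xget (cst 0) (is_density mu).

Definition relaxed_control gam :=
  (forall t, 0 <= t <= T -> gam t U = 1%E) /\
  (forall A : set (borel R d), measurable A ->
     measurable_fun `[0, T] (fun t => gam t A)).

Definition admissible gam :=
  relaxed_control gam /\ forall t, 0 <= t <= T -> cp_K p (gam t).

Definition avg_drift t x mu : 'rV[R]_m :=
  \row_j \int[mu]_(a in U) b t x a 0 j.

(* x is required to be controlled with Gubinelli derivative sigma(r, x_r); the
   j-th row of sigma(r, x_r) then has the derivative given below. *)
Definition vol_deriv (x : R -> 'rV[R]_m) (j : 'I_m) (r : R) : 'M[R]_d :=
  \matrix_(i, i1) \sum_k
    pderiv k (fun z => sigma r z j i) (x r) * sigma r (x r) k i1.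

Definition rde_solution s y gam (x : R -> 'rV[R]_m) :=
  weakly_controlled (cp_zeta p) (cp_kappa p) s T x (fun r => sigma r (x r)) /\
  forall t j, s <= t <= T ->
    is_rough_integral (cp_zeta p) (cp_zeta2 p)
      (fun r => row j (sigma r (x r))) (vol_deriv x j) s t
      (x t 0 j - y 0 j
       - \int[lebesgue_measure]_(r in `[s, t]) avg_drift r (x r) (gam r) 0 j).

Definition well_posed :=
  forall s y gam, 0 <= s <= T -> relaxed_control gam ->
    (exists x : R -> 'rV[R]_m, rde_solution s y gam x) /\
    forall x x' : R -> 'rV[R]_m,
      rde_solution s y gam x -> rde_solution s y gam x' ->
      forall t, s <= t <= T -> x t = x' t.

Definition state s y gam : R -> 'rV[R]_m :=
  xget (cst y) (rde_solution s y gam).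

(* A measure without density, in particular a Dirac mass, gets no entropy
   term. *)
Definition running_reward s x mu : R :=
  if `[< has_density mu >] then
    \int[cp_leb p]_(u in U) (rw s x u * density mu u)
    - cp_lambda p * \int[cp_leb p]_(u in U) (density mu u * ln (density mu u))
  else \int[mu]_(u in U) rw s x u.

Definition payoff t y gam : R :=
  \int[lebesgue_measure]_(r in `[t, T])
     running_reward r (state t y gam r) (gam r)
  + cp_terminal p (state t y gam T).

Definition value t y : R := sup [set payoff t y gam | gam in admissible].

Definition Htilde t y a P : R := dotp P (b t y a) + rw t y a.

Definition Hamiltonian t y mu P : R :=
  dotp P (avg_drift t y mu) + running_reward t y mu.

Definition perturb gam t mu (beta : R) : R -> prob :=
  fun r => if t <= r <= t + beta then mu else gam r.

Definition Q_beta (beta : R) t y mu gam : R :=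
  payoff t y (perturb gam t mu beta).

Definition q_quotient t y mu gam : R -> R :=
  fun beta => beta^-1 * (Q_beta beta t y mu gam - payoff t y gam).

Definition q_function t y mu gam : R := lim (q_quotient t y mu gam @ 0^'+).

Definition q_point t y a gam : R := q_function t y (dirac_prob a) gam.

Definition gibbs t y P a : R :=
  expR ((cp_lambda p)^-1 * Htilde t y a P)
  / \int[cp_leb p]_(a' in U) expR ((cp_lambda p)^-1 * Htilde t y a' P).

Definition tv_dist mu nu : R :=
  sup [set `|fine (mu A) - fine (nu A)| | A in @measurable _ (borel R d)].

Record standing_assumptions : Prop := {
  sa_dim : (0 < d)%N ;
  sa_horizon : 0 < T ;
  sa_exponents : 3%:R^-1 < cp_kappa p /\ cp_kappa p < cp_alpha p ;
  sa_noise : rough_path T (cp_alpha p) (cp_zeta p) (cp_zeta2 p) ;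
  sa_domain : compact_domain U ;
  sa_leb : is_lebesgue (cp_leb p) ;
  sa_b_smooth : forall j, Cb011 T U (fun t x a => b t x a 0 j) ;
  sa_b_time : forall eps, 0 < eps -> exists2 eta, 0 < eta &
    forall s t x a, 0 <= s <= T -> 0 <= t <= T -> U a ->
      `|t - s| < eta -> `|b t x a - b s x a| < eps ;
  sa_b_lip : exists L, forall t x y a, 0 <= t <= T -> U a ->
    `|b t x a - b t y a| <= L * `|x - y| ;
  sa_sigma : forall j i, Cb13 T (fun t x => sigma t x j i) ;
  sa_well_posed : well_posed ;
  sa_beta0 : 0 < cp_beta0 p ;
  (* K may be any set of such measures: on the set of all of them the entropy
     is unbounded when beta0 |U| < 1, which sa_F_bounded excludes. *)
  sa_K : forall mu, cp_K p mu -> mu U = 1%E /\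
    exists2 f, is_density mu f & forall a, U a -> cp_beta0 p <= f a ;
  sa_lambda : 0 < cp_lambda p ;
  sa_reward : measurable_fun
    [set z : R * borel R m * borel R d | 0 <= z.1.1 <= T /\ U z.2]
    (fun z => rw z.1.1 z.1.2 z.2) ;
  sa_F_defined : forall s x mu f, 0 <= s <= T -> cp_K p mu -> is_density mu f ->
    (cp_leb p).-integrable U (fun u => (rw s x u * f u)%:E) /\
    (cp_leb p).-integrable U (fun u => (f u * ln (f u))%:E) ;
  sa_F_bounded : exists C, forall s x mu, 0 <= s <= T -> cp_K p mu ->
    `|running_reward s x mu| <= C ;
  sa_F_lip_x : exists L, forall s x y mu, 0 <= s <= T -> cp_K p mu ->
    `|running_reward s x mu - running_reward s y mu| <= L * `|x - y| ;
  sa_F_lip_gam : exists L, forall s x mu nu, 0 <= s <= T ->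
    cp_K p mu -> cp_K p nu ->
    `|running_reward s x mu - running_reward s x nu| <= L * tv_dist mu nu ;
  sa_terminal : continuous (cp_terminal p) /\
    exists C, forall x, `|cp_terminal p x| <= C }.

Definition optimal x0 gam :=
  admissible gam /\
  forall t, 0 <= t <= T ->
    value t (state 0 x0 gam t) = payoff t (state 0 x0 gam t) gam.

Definition gradients_agree x0 gam :=
  forall t, 0 <= t < T -> let y := state 0 x0 gam t in
    [/\ differentiable (value t) y,
        differentiable (fun z => payoff t z gam) y &
        grad (value t) y = grad (fun z => payoff t z gam) y].

(* The limit defining q exists along the path of gam and is the increment of
   the Hamiltonian. *)
Definition q_is_hamiltonian_increment x0 gam :=
  forall t mu, 0 <= t < T ->
    (cp_K p mu \/ exists2 a, U a & mu = dirac_prob a) ->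
    let y := state 0 x0 gam t in
    let P := grad (fun z => payoff t z gam) y in
    q_quotient t y mu gam @ 0^'+ -->
      Hamiltonian t y mu P - Hamiltonian t y (gam t) P.

End control.

(* Main.v *)
Require Import Defs.
From mathcomp Require Import all_boot all_order all_algebra.
From mathcomp Require Import all_classical all_reals all_analysis.
From mathcomp Require Import measurable_realfun.

Set Implicit Arguments.
Unset Strict Implicit.
Unset Printing Implicit Defensive.

Import Order.TTheory GRing.Theory Num.Theory.
Import numFieldNormedType.Exports.

Local Open Scope classical_set_scope.
Local Open Scope ring_scope.

(** Write [y] for the state of the optimal policy [gamma] at time [t] and [P] for
    the common gradient of the value function and of the payoff of [gamma] at
    [y]. The limit defining [q] at the action [a] is the increment
    [H (delta_a) - H (gamma_t)] of the Hamiltonian with costate [P], and both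
    terms can be computed.

    The Hamiltonian at a Dirac mass is [Htilde t y a P] ([Hamiltonian_dirac]). The
    entropy term is absent because a Dirac mass has no density: points are
    Lebesgue null as [0 < d] ([dirac_no_density]).

    The Hamiltonian at a measure with density [f] is the integral over [U] of
    [Htilde * f - lambda * f * ln f] ([Hamiltonian_density]). If
    [f = exp (Htilde / lambda) / Z] on [U], then [lambda * ln f] equals
    [Htilde - lambda * ln Z], so the integrand collapses to
    [lambda * ln Z * f], and the Hamiltonian at [gamma_t] is [lambda * ln Z]
    ([Hamiltonian_gibbs]): the log-partition function is the value of the
    entropy-regularised maximum.

    Hence [q = Htilde - lambda * ln Z], and [exp (q / lambda)] is
    [exp (Htilde / lambda) / Z], the Gibbs density.

    What remains is measure theory: the drift is averaged against the measure
    [gamma_t] while the reward and the entropy are Lebesgue integrals against a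
    density, which is moreover determined only almost everywhere. The former are
    turned into the latter by [Rintegral_density], and [density_ae_eq] lets the
    Gibbs density replace the chosen one. *)

(** * Integration against a density *)

Section integration_against_a_density.
Context d (T : measurableType d) (R : realType).
Variables (nu mu : {measure set T -> \bar R}) (f : T -> R).
Hypotheses (mf : measurable_fun [set: T] f) (f_ge0 : forall x, 0 <= f x).
Hypothesis nuE : forall A, measurable A -> nu A = (\int[mu]_(x in A) (f x)%:E)%E.

Import HBNNSimple.
Local Open Scope ereal_scope.

Let mEf D : measurable_fun D (EFin \o f).
Proof. exact/measurable_EFinP/measurable_funTS. Qed.

(** On an indicator the identity is the definition of a density; a simple function
    is a finite nonnegative combination of indicators of its level sets. *)
Let integral_density_nnsfun (D : set T) (h : {nnsfun T >-> R}) : measurable D ->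
  \int[nu]_(x in D) (h x)%:E = \int[mu]_(x in D) ((h x)%:E * (f x)%:E).
Proof.
move=> mD.
pose c y x := (y * \1_(h @^-1` [set y]) x)%:E.
have mc y : measurable_fun D (c y).
  by apply: (measurable_comp measurableT) => //; exact: measurable_funM.
have hE x : (h x)%:E = \sum_(y \in range h) c y x.
  by rewrite fimfunE -fsumEFin.
under eq_integral do rewrite hE.
rewrite ge0_integral_fsum//; last by move=> y x _; exact: nnfun_muleindic_ge0.
transitivity (\int[mu]_(x in D) \sum_(y \in range h) (c y x * (f x)%:E)).
  rewrite ge0_integral_fsum//; last 2 first.
  - by move=> y; exact: emeasurable_funM.
  - by move=> y x _; rewrite mule_ge0 ?lee_fin//; exact: nnfun_muleindic_ge0.
  apply: eq_fsbigr => r rh; rewrite /c.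
  under eq_integral do rewrite EFinM.
  rewrite integralZl_indic_nnsfun//.
  under [RHS]eq_integral do rewrite EFinM -muleA.
  rewrite ge0_integralZl//; last 3 first.
  - by apply: emeasurable_funM => //; exact/measurable_EFinP.
  - by move=> x _; rewrite mule_ge0 ?lee_fin.
  - by move: rh; rewrite inE => -[x _ <-]; rewrite lee_fin.
  congr (_ * _); under [RHS]eq_integral do rewrite muleC.
  rewrite [RHS](eq_integral ((EFin \o f) \_ (h @^-1` [set r]))); last first.
    by move=> x _; rewrite epatch_indic.
  by rewrite -integral_mkcondr -nuE ?integral_indic 1?setIC//; exact: measurableI.
apply: eq_integral => x _; rewrite hE ge0_mule_fsuml// => y.
exact: nnfun_muleindic_ge0.
Qed.

(** Simple functions increasing to [g] and monotone convergence on both sides. *)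
Let ge0_integral_density (D : set T) (g : T -> \bar R) : measurable D ->
  measurable_fun D g -> (forall x, 0 <= g x) ->
  \int[nu]_(x in D) g x = \int[mu]_(x in D) (g x * (f x)%:E).
Proof.
move=> mD mg g0; pose h := nnsfun_approx mD mg.
have cvgh x : D x -> (h n x)%:E @[n --> \oo] --> g x.
  by move=> Dx; exact: cvg_nnsfun_approx.
have ndh x : nondecreasing_seq (fun n => (h n x)%:E).
  by move=> m n mn; rewrite lee_fin; exact/lefP/nd_nnsfun_approx.
transitivity (limn (fun n => \int[nu]_(x in D) (h n x)%:E)).
  rewrite -monotone_convergence//.
  - by apply: eq_integral => x /[!inE] Dx; exact/esym/cvg_lim/cvgh.
  - by move=> n; exact/measurable_EFinP/measurable_funTS.
  - by move=> n x _; rewrite lee_fin.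
under eq_fun do rewrite integral_density_nnsfun//.
rewrite -monotone_convergence//.
- apply: eq_integral => x /[!inE] Dx; apply/cvg_lim => //.
  by apply: cvgeZr => //; exact: cvgh.
- move=> n; apply: emeasurable_funM => //.
  exact/measurable_EFinP/measurable_funTS.
- by move=> n x _; rewrite mule_ge0 ?lee_fin.
- by move=> x _ m n mn; rewrite lee_wpmul2r ?lee_fin//; exact: ndh.
Qed.

(** A nonnegative weight commutes with positive and negative parts, so the
    nonnegative case gives the identity for every measurable function, without
    an integrability condition. *)
Lemma integral_density (D : set T) (g : T -> \bar R) : measurable D ->
  measurable_fun D g ->
  \int[nu]_(x in D) g x = \int[mu]_(x in D) (g x * (f x)%:E).
Proof.
move=> mD mg.
rewrite integralE [RHS]integralE.
rewrite ge0_integral_density//; last exact: measurable_funepos.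
rewrite ge0_integral_density//; last exact: measurable_funeneg.
congr (_ - _); apply: eq_integral => x _.
  by rewrite !funeposE maxe_pMl ?lee_fin// mul0e.
by rewrite !funenegE maxe_pMl ?lee_fin// mul0e mulNe.
Qed.

Lemma Rintegral_density (D : set T) (g : T -> R) : measurable D ->
  measurable_fun D g ->
  (\int[nu]_(x in D) g x = \int[mu]_(x in D) (g x * f x))%R.
Proof.
by move=> mD mg; rewrite /Rintegral integral_density//; exact/measurable_EFinP.
Qed.

End integration_against_a_density.

(** * Borel sets and functions on row vectors *)

Lemma compact_measurable_borel (R : realType) n (U : set 'rV[R]_n) :
  compact U -> measurable (U : set (borel R n)).
Proof.
move=> /(compact_closed (@norm_hausdorff _ _)) /closed_openC oU.
rewrite -(setCK U); apply: measurableC.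
exact: sub_sigma_algebra.
Qed.

(** The preimage of an open set by [f] is relatively open in [D], and [g] pulls it
    back to a relatively open subset of [U]. This makes a section of [f] Borel
    whatever sigma-algebra the total space [X] carries. *)
Lemma measurable_section_within_continuous (R : realType) n
    (X : topologicalType) (D : set X) (f : X -> R) (g : 'rV[R]_n -> X)
    (U : set 'rV[R]_n) :
  measurable (U : set (borel R n)) -> continuous g ->
  (forall u, U u -> D (g u)) -> {within D, continuous f} ->
  measurable_fun (U : set (borel R n)) (f \o g : borel R n -> R).
Proof.
move=> mU cg UD /continuousP cf.
apply: (measurability _ (RGenOpens.measurableE R)).
move=> _ [_ [a [b ->] <-]].
have /open_subspaceP [W oW WD] := cf _ (@interval_open R (BRight a) (BLeft b) isT isT).
rewrite (_ : _ `&` _ = U `&` (g @^-1` W)).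
  apply: measurableI => //; apply: sub_sigma_algebra.
  by move/continuousP: cg; exact.
apply/seteqP; split=> u [Uu Au]; split=> //.
  have : ((f @^-1` [set` `]a, b[]) `&` D) (g u) by split=> //; exact: UD.
  by rewrite -WD => -[].
have : (W `&` D) (g u) by split=> //; exact: UD.
by rewrite WD => -[].
Qed.

(** * Measurability of the drift and of the reward *)

Section gibbs_policy.
Context (R : realType) (d m : nat) (p : control_problem R d m).
Hypothesis Hp : standing_assumptions p.

Local Notation prob := (probability (borel R d) R).
Local Notation T := (cp_horizon p).
Local Notation U := (cp_U p).
Local Notation b := (cp_b p).
Local Notation rw := (cp_reward p).
Local Notation leb := (cp_leb p).
Local Notation lambda := (cp_lambda p).
Implicit Types (mu : prob) (f g : 'rV[R]_d -> R).

Let mU : measurable (U : set (borel R d)).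
Proof. by apply: compact_measurable_borel; have [] := sa_domain Hp. Qed.

Lemma measurable_drift t y j : 0 <= t <= T ->
  measurable_fun (U : set (borel R d)) (fun a : borel R d => b t y a 0 j).
Proof.
move=> tT; have [[cb _] _] := sa_b_smooth Hp j.
pose D := [set z : R * 'rV[R]_m * 'rV[R]_d | 0 <= z.1.1 <= T /\ U z.2].
apply: (@measurable_section_within_continuous _ _ _ D
  (fun z => b z.1.1 z.1.2 z.2 0 j) (fun a => (t, y, a))) => //.
move=> a; have cty : (fun=> (t, y)) @ a --> (t, y).
  exact: (@cst_continuous _ _ (t, y) a).
exact: cvg_pair cty cvg_id.
Qed.

Lemma bounded_drift t y j : 0 <= t <= T ->
  [bounded b t y a 0 j | a in U].
Proof.
move=> tT; have [[_ [C bC]] _] := sa_b_smooth Hp j.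
exists C; split; first exact: num_real.
move=> M CM a Ua /=; apply: le_trans (ltW CM).
exact: (bC (t, y, a)).
Qed.

Lemma measurable_reward t y : 0 <= t <= T ->
  measurable_fun (U : set (borel R d)) (fun a : borel R d => rw t y a).
Proof.
move=> tT.
pose D := [set z : R * borel R m * borel R d | 0 <= z.1.1 <= T /\ U z.2].
pose h (a : borel R d) : R * borel R m * borel R d := (t, y, a).
have mh : measurable_fun (U : set (borel R d)) h.
  apply/measurable_funTS/measurable_fun_pair; last exact: measurable_id.
  exact: measurable_cst.
have mD : measurable D.
  have -> : D = (fst \o fst) @^-1` `[0, T] `&` snd @^-1` U.
    by apply/seteqP; split=> z /=; rewrite in_itv.
  apply: measurableI; rewrite -[X in measurable X]setTI.
    exact: (measurableT_comp measurable_fst measurable_fst).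
  exact: measurable_snd.
apply: (measurable_comp mD _ (sa_reward Hp) mh).
by move=> _ [a Ua <-].
Qed.

(** * The Hamiltonian at a Dirac mass *)

(** A point is a degenerate box, whose volume is a product with a factor [0] since
    [0 < d]. *)
Lemma lebesgue_point (a : borel R d) : leb [set a] = 0%E.
Proof.
have -> : [set a] = [set x : borel R d | forall i, a 0 i <= x 0 i <= a 0 i].
  apply/seteqP; split=> [x -> i|x xa]; first by rewrite lexx.
  by apply/rowP => i; apply/eqP; rewrite eq_le andbC.
rewrite (sa_leb Hp) => [|i]; last exact: lexx.
case: d (sa_dim Hp) a => // n _ a.
by rewrite big_ord_recl subrr mul0r.
Qed.

Lemma dirac_no_density a : ~ has_density p (dirac_prob a).
Proof.
move=> [f [mf f0 fE]].
have ma : measurable ([set a] : set (borel R d)).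
  by apply: compact_measurable_borel; exact: compact_set1.
have := fE _ ma; rewrite null_set_integral//; last 2 first.
- exact/measurable_EFinP/measurable_funTS.
- exact: lebesgue_point.
by move=> /eqP; rewrite /= diracE mem_set// onee_eq0.
Qed.

Lemma Rintegral_dirac a g : U a ->
  measurable_fun (U : set (borel R d)) (g : borel R d -> R) ->
  \int[dirac_prob a]_(x in U) g x = g a.
Proof.
move=> Ua mg; rewrite /Rintegral integral_dirac//; last exact/measurable_EFinP.
by rewrite diracE mem_set// mul1e.
Qed.

Lemma Hamiltonian_dirac t y a P : 0 <= t <= T -> U a ->
  Hamiltonian p t y (dirac_prob a) P = Htilde p t y a P.
Proof.
move=> tT Ua; rewrite /Hamiltonian /Htilde /running_reward asboolF; last first.
  exact: dirac_no_density.
rewrite (Rintegral_dirac Ua (measurable_reward y tT)); congr (dotp _ _ + _).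
apply/rowP => j; rewrite mxE.
by rewrite (Rintegral_dirac Ua (measurable_drift y j tT)).
Qed.

(** * The Hamiltonian at a measure with a density *)

Lemma density_measurable mu f D : is_density p mu f ->
  measurable_fun (D : set (borel R d)) (EFin \o (f : borel R d -> R)).
Proof. by move=> [mf _ _]; exact/measurable_EFinP/measurable_funTS. Qed.

Lemma density_integrable mu f D : is_density p mu f -> measurable D ->
  leb.-integrable (D : set (borel R d)) (fun a => (f a)%:E).
Proof.
move=> fmu mD; have [mf f0 fE] := fmu.
apply/integrableP; split; first exact: density_measurable fmu.
under eq_integral do rewrite /= ger0_norm//.
by rewrite -fE// (le_lt_trans (probability_le1 _ _))// ltry.
Qed.

(** The running reward is defined by a density picked by a choice operator, which
    need not be the one at hand; two densities have the same integrals over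
    measurable sets, so they differ on a null set only. *)
Lemma density_ae_eq mu f g D : is_density p mu f -> is_density p mu g ->
  measurable D ->
  ae_eq leb (D : set (borel R d)) (fun a => (f a)%:E) (fun a => (g a)%:E).
Proof.
move=> fmu gmu mD; have [_ _ fE] := fmu; have [_ _ gE] := gmu.
apply: integral_ae_eq => //.
- exact: density_integrable fmu _.
- exact: density_measurable gmu.
- by move=> E _ mE; rewrite -fE// -gE.
Qed.

Lemma running_reward_density t y mu f : 0 <= t <= T -> is_density p mu f ->
  running_reward p t y mu = \int[leb]_(a in U) (rw t y a * f a)
    - lambda * \int[leb]_(a in U) (f a * ln (f a)).
Proof.
move=> tT fmu; have mu_dens : has_density p mu by exists f.
rewrite /running_reward asboolT//.
have dmu : is_density p mu (density p mu) by exact: xgetPex.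
have mln g : is_density p mu g -> measurable_fun (U : set (borel R d))
    (fun a : borel R d => (g a * ln (g a))%:E).
  move=> [mg _ _]; apply/measurable_EFinP/measurable_funTS/measurable_funM => //.
  exact: measurableT_comp (@measurable_ln R) mg.
have mrw g : is_density p mu g -> measurable_fun (U : set (borel R d))
    (fun a : borel R d => (rw t y a * g a)%:E).
  move=> [mg _ _]; apply/measurable_EFinP/measurable_funM.
    exact: measurable_reward.
  exact: measurable_funTS.
have dfE := density_ae_eq dmu fmu mU.
congr (_ - _ * _); rewrite /Rintegral; congr fine; apply: ae_eq_integral => //;
  try exact: mln; try exact: mrw; apply: filterS dfE => a /[apply].
- by move=> [->].
- by move=> [->].
Qed.

Lemma drift_density_integrable t y j mu f : 0 <= t <= T -> is_density p mu f ->
  leb.-integrable (U : set (borel R d)) (fun a => (b t y a 0 j * f a)%:E).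
Proof.
move=> tT fmu; under eq_fun do rewrite EFinM.
apply: (integrableMr mU (h := fun a : borel R d => b t y a 0 j)).
- exact: measurable_drift.
- exact: bounded_drift.
- exact: density_integrable fmu _.
Qed.

(** The average of the drift against [mu] becomes a Lebesgue integral by
    [Rintegral_density]. The drift term is integrable because the drift is
    bounded, the reward and entropy terms are by assumption, so that the three
    may be put under one integral. *)
Lemma Hamiltonian_density t y P mu f : 0 <= t <= T ->
  cp_K p mu -> is_density p mu f ->
  Hamiltonian p t y mu P =
  \int[leb]_(a in U) (Htilde p t y a P * f a - lambda * (f a * ln (f a))).
Proof.
move=> tT Kmu fmu; have [mf f0 fE] := fmu.
have [irw iln] := sa_F_defined Hp y tT Kmu fmu.
have ib j : leb.-integrable U (fun a => (P 0 j * (b t y a 0 j * f a))%:E).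
  under eq_fun do rewrite EFinM; apply: integrableZl => //.
  exact: drift_density_integrable tT fmu.
have idot : leb.-integrable U
    (EFin \o (fun a => \sum_j P 0 j * (b t y a 0 j * f a))).
  rewrite (_ : _ \o _ = fun a => \sum_j (P 0 j * (b t y a 0 j * f a))%:E)%E.
    by apply: integrable_sum.
  by apply/funext => a; rewrite /= sumEFin.
have dotE : dotp P (avg_drift p t y mu) =
    \int[leb]_(a in U) (\sum_j P 0 j * (b t y a 0 j * f a)).
  rewrite /Rintegral; under eq_integral do rewrite -sumEFin.
  rewrite integral_sum// -sum_fine => [|j _]; last exact: integrable_fin_num (ib j).
  apply: eq_bigr => j _; rewrite mxE.
  rewrite (Rintegral_density mf f0 fE)//; last exact: measurable_drift.
  by rewrite -RintegralZl//; exact: drift_density_integrable tT fmu.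
rewrite /Hamiltonian (running_reward_density y tT fmu) dotE addrA.
rewrite -RintegralD// -RintegralZl// -RintegralB//; last 2 first.
- exact: (integrableD mU idot irw).
- exact: (integrableZl mU lambda iln).
apply: eq_Rintegral => a _; congr (_ - _).
rewrite mulrDl; congr (_ + _); rewrite /dotp mulr_suml.
by apply: eq_bigr => j _; rewrite mulrA.
Qed.

(** * Gibbs densities *)

(** For a Gibbs density, [Htilde - lambda * ln f] is the constant
    [lambda * ln Z] on [U], and [f] has total mass [1] there. *)
Lemma Hamiltonian_gibbs t y P mu f Z : 0 <= t <= T ->
  cp_K p mu -> is_density p mu f -> 0 < Z ->
  (forall a, U a -> f a = expR (lambda^-1 * Htilde p t y a P) / Z) ->
  Hamiltonian p t y mu P = lambda * ln Z.
Proof.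
move=> tT Kmu fmu Z0 fE; have [mf f0 muE] := fmu.
have lambda0 : lambda != 0 by rewrite gt_eqF// (sa_lambda Hp).
rewrite (Hamiltonian_density y P tT Kmu fmu).
transitivity (\int[leb]_(a in U) (lambda * ln Z * f a)).
  apply: eq_Rintegral => a /[!inE] Ua.
  (* [f a] is factored out; the identity left is [Htilde - lambda * ln (f a) =
     lambda * ln Z]. *)
  rewrite mulrCA mulrC -mulrBr mulrC; congr (_ * _).
  rewrite [in ln _]fE// ln_div ?posrE ?expR_gt0// expRK.
  by rewrite mulrBr mulVKf// opprB addrC subrK.
have [muU _] := sa_K Hp Kmu.
rewrite RintegralZl//; last exact: density_integrable fmu _.
by rewrite /Rintegral -muE// muU mulr1.
Qed.

(** If the partition function vanished, or were an infinite integral, which the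
    real-valued integral evaluates to [0], then dividing by it would give the
    density [0] on [U], against [mu U = 1]. *)
Lemma gibbs_partition_gt0 t y P mu f : mu U = 1%E -> is_density p mu f ->
  (forall a, U a -> f a = gibbs p t y P a) ->
  0 < \int[leb]_(a in U) expR (lambda^-1 * Htilde p t y a P).
Proof.
move=> muU [_ _ muE] fE; rewrite lt_neqAle Rintegral_ge0 ?andbT; last first.
  by move=> a _; exact: expR_ge0.
apply/eqP => Z0; move: muU; rewrite muE// integral0_eq => [/esym/eqP|a Ua].
  by rewrite onee_eq0.
by rewrite fE// /gibbs -Z0 invr0 mulr0.
Qed.

End gibbs_policy.

Theorem proposition5p5 (R : realType) (d m : nat) (p : control_problem R d m)
    (x0 : 'rV[R]_m)
    (gamma : R -> probability (borel R d) R) (gamma_dot : R -> 'rV[R]_d -> R)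
    (Hp : standing_assumptions p)
    (Hopt : optimal p x0 gamma)
    (Hgrad : gradients_agree p x0 gamma)
    (Hq : q_is_hamiltonian_increment p x0 gamma)
    (Hdens : forall t, 0 <= t < cp_horizon p ->
       is_density p (gamma t) (gamma_dot t))
    (Hgibbs : forall t a, 0 <= t < cp_horizon p -> cp_U p a ->
       let y := state p 0 x0 gamma t in
       gamma_dot t a = gibbs p t y (grad (value p t) y) a) :
  forall t a, 0 <= t < cp_horizon p -> cp_U p a ->
    let y := state p 0 x0 gamma t in
    gamma_dot t a = expR ((cp_lambda p)^-1 * q_point p t y a gamma).
Proof.
move=> t a tT Ua y.
have tT' : 0 <= t <= cp_horizon p by case/andP: tT => -> /ltW.
have [[_ K_gamma] _] := Hopt; have Kt := K_gamma _ tT'.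
have [_ _ gradE] := Hgrad t tT.
have gE u : cp_U p u -> gamma_dot t u = gibbs p t y (grad (value p t) y) u.
  by move=> Uu; exact: Hgibbs.
have [muU _] := sa_K Hp Kt.
have Z_gt0 := gibbs_partition_gt0 Hp muU (Hdens t tT) gE.
have lambda_neq0 : cp_lambda p != 0 by rewrite gt_eqF// (sa_lambda Hp).
(* The gradients of the value function and of the payoff agree at [y], so [q] is
   an increment of the Hamiltonian with the costate of the Gibbs density. *)
have qE : q_point p t y a gamma =
    Hamiltonian p t y (dirac_prob a) (grad (value p t) y)
    - Hamiltonian p t y (gamma t) (grad (value p t) y).
  rewrite gradE; apply: cvg_lim => //.
  by apply: Hq => //; right; exists a.
rewrite qE Hamiltonian_dirac// (Hamiltonian_gibbs Hp tT' Kt (Hdens t tT) Z_gt0)//.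
by rewrite mulrBr mulKf// expRB lnK ?posrE// gE.
Qed.
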